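(* Let $E\subset\Delta_n$ be finite and suppose the market weight sequence $\{\mu(t)\}_{t\ge0}$ takes values in $E$. Let $\Theta=(\overline{\Delta}_n)^E$ be the set of all portfolio maps $\pi:E\to\overline{\Delta}_n$ with the topology of uniform (equivalently pointwise) convergence, and let $\nu_0$ be a Borel probability measure on $\Theta$ with full support. Then: (i) $\lim_{t\to\infty}\frac1t\log\frac{\widehat V(t)}{V^*(t)}=0$, i.e. Cover's portfolio $\widehat\pi$ satisfies the universality property. (ii) If $\mathbb P_t$ converges weakly to a probability measure $\mathbb P$ on $E\times E$, then $\{\nu_t\}_{t\ge0}$ satisfies the large deviation principle on $\Theta$ with the convex rate function $I(\pi)=W^*-W(\pi)$, where $W(\pi)=\lim_{t\to\infty}\frac1t\log V_\pi(t)$ and $W^*=\max_{\pi\in\Theta}W(\pi)$.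
   Context: $\Delta_n$ is the open unit simplex in $\mathbb R^n$ ($n\ge2$), $\overline{\Delta}_n$ the closed one. Relative value: $V_\pi(0)=1$, $V_\pi(t+1)=V_\pi(t)\sum_i\pi_i(\mu(t))\mu_i(t+1)/\mu_i(t)$. $\widehat V(t)=\int_\Theta V_\pi(t)\,d\nu_0(\pi)$, which is the relative value of Cover's portfolio $\widehat\pi(t)=\int_\Theta\pi(\mu(t))\,d\nu_t(\pi)$; $V^*(t)=\sup_{\pi\in\Theta}V_\pi(t)$; wealth distribution $\nu_t(B)=\frac1{\widehat V(t)}\int_BV_\pi(t)\,d\nu_0(\pi)$. $\mathbb P_t=\frac1t\sum_{s=0}^{t-1}\delta_{(\mu(s),\mu(s+1))}$. Full support: the smallest closed set of full $\nu_0$-measure is $\Theta$. LDP with rate $I$: for closed $F$, $\limsup_t\frac1t\log\nu_t(F)\le-\inf_FI$; for open $G$, $\liminf_t\frac1t\log\nu_t(G)\ge-\inf_GI$. *)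

(* Defs.v *)
From HB Require Import structures.
From mathcomp Require Import all_boot all_order all_algebra.
From mathcomp Require Import all_classical all_reals all_analysis.
Set Implicit Arguments. Unset Strict Implicit. Unset Printing Implicit Defensive.
Import Order.TTheory GRing.Theory Num.Theory.
Import numFieldNormedType.Exports.
Local Open Scope classical_set_scope.
Local Open Scope ring_scope.

(* Conventions:
   - the finite set E = {e_0,...,e_(k-1)} of market weights is enumerated
     injectively by  e : 'I_k -> 'rV[R]_n ;
   - the market weight sequence is mu(t) = e (idx t), idx : nat -> 'I_k ;
   - a portfolio map pi : E -> closed simplex is a matrix pi : 'M[R]_(k,n)
     whose j-th row is pi(e_j); Theta is a subset of 'M[R]_(k,n) with the
     (product = uniform) topology of matrices. *)

Section Defs.
Variables (R : realType) (n k : nat).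

Definition open_simplex : set 'rV[R]_n :=
  [set x | (forall i, 0 < x ord0 i) /\ \sum_i x ord0 i = 1].

Definition closed_simplex : set 'rV[R]_n :=
  [set x | (forall i, 0 <= x ord0 i) /\ \sum_i x ord0 i = 1].

Definition Theta : set 'M[R]_(k, n) :=
  [set p | forall j : 'I_k, closed_simplex (row j p)].

Definition BorelM := g_sigma_algebraType (@open 'M[R]_(k, n)).

Variables (e : 'I_k -> 'rV[R]_n) (idx : nat -> 'I_k).

Definition mu (t : nat) : 'rV[R]_n := e (idx t).

Fixpoint relval (p : 'M[R]_(k, n)) (t : nat) : R :=
  match t with
  | 0 => 1
  | t'.+1 => relval p t' *
      \sum_i p (idx t') i * (mu t'.+1 ord0 i / mu t' ord0 i)
  end.

Variable nu0 : probability BorelM R.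

Definition Vhat (t : nat) : R :=
  fine (\int[nu0]_(p in (Theta : set BorelM)) (relval p t)%:E)%E.

Definition Vstar (t : nat) : R := sup [set relval p t | p in Theta].

Definition nu_t (t : nat) (B : set 'M[R]_(k, n)) : \bar R :=
  ((Vhat t)^-1)%:E * \int[nu0]_(p in (B : set BorelM)) (relval p t)%:E.

Definition Wgrowth (p : 'M[R]_(k, n)) : R :=
  lim ((fun t : nat => t%:R^-1 * ln (relval p t)) @ \oo).

(* W^* = max_{pi in Theta} W(pi) (as a supremum; attainment is asserted
   in the theorem) *)
Definition Wstar : R := sup [set Wgrowth p | p in Theta].

Definition rateI (p : 'M[R]_(k, n)) : R := Wstar - Wgrowth p.

End Defs.
Arguments Theta R n k : clear implicits.
Arguments BorelM R n k : clear implicits.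

Definition full_support (R : realType) (n k : nat)
    (nu0 : probability (BorelM R n k) R) : Prop :=
  @closed 'M[R]_(k, n) (Theta R n k) /\ nu0 (Theta R n k) = 1%E /\
  forall F : set 'M[R]_(k, n), closed F -> nu0 F = 1%E -> Theta R n k `<=` F.

(* Weak convergence of P_t = (1/t) sum_{s<t} delta_(mu(s),mu(s+1)) to a
   probability P on E x E.  E x E is finite (discrete), so every function on
   it is bounded continuous; P is given by its masses P i j on (e_i, e_j). *)
Definition empirical_weak_cvg (R : realType) (k : nat) (idx : nat -> 'I_k)
    (P : 'I_k -> 'I_k -> R) : Prop :=
  forall f : 'I_k -> 'I_k -> R,
    (fun t : nat => t%:R^-1 * \sum_(s < t) f (idx s) (idx s.+1)) @ \oo
      --> \sum_i \sum_j P i j * f i j.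

Definition is_prob_mass (R : realType) (k : nat) (P : 'I_k -> 'I_k -> R) :=
  (forall i j, 0 <= P i j) /\ \sum_i \sum_j P i j = 1.

(* Main.v *)
(* On [Theta] every one-step gain lies in a fixed interval [[c, C]] with [c > 0],
   so its logarithm is Lipschitz and [(ln V_p(t)) / t] is equi-Lipschitz in [p],
   uniformly in [t].  Balls of a given radius centred in the compact [Theta]
   have [nu0]-mass bounded below, hence [ln V_p(t) <= ln Vhat(t) + C + eps t]
   uniformly in [p], which gives (i).  When the empirical pair measures converge
   to [P], [(ln V_p(t)) / t] converges uniformly on [Theta] to
   [sum_ij P_ij ln (gain_ij p)]; both bounds of the large deviation principle
   then follow by estimating [V_p(t)] pointwise on the set (upper bound) or on a
   small ball inside it (lower bound). *)
Require Import Defs.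
From HB Require Import structures.
From mathcomp Require Import all_boot all_order all_algebra.
From mathcomp Require Import all_classical all_reals all_analysis.
From mathcomp Require Import measurable_realfun ring lra.
Import Order.TTheory GRing.Theory Num.Theory.
Import numFieldNormedType.Exports.
Local Open Scope classical_set_scope.
Local Open Scope ring_scope.

(** * Convexity and compactness of the set of portfolio maps *)

Section Simplices.
Context {R : realType} {n k : nat}.
Implicit Types p q : 'M[R]_(k, n).

Lemma Theta_ge0 p i l : Theta R n k p -> 0 <= p i l.
Proof. by move=> /(_ i)[/(_ l)]; rewrite mxE. Qed.

Lemma Theta_sum p i : Theta R n k p -> \sum_l p i l = 1.
Proof. by move=> /(_ i)[_ <-]; apply: eq_bigr => l _; rewrite mxE. Qed.

Lemma Theta_le1 p i l : Theta R n k p -> p i l <= 1.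
Proof.
move=> Tp; rewrite -(Theta_sum p i Tp) (bigD1 l)//= lerDl.
by apply: sumr_ge0 => ? _; exact: Theta_ge0.
Qed.

Lemma Theta_convex p q (a : R) : Theta R n k p -> Theta R n k q ->
  0 <= a <= 1 -> Theta R n k (a *: p + (1 - a) *: q).
Proof.
move=> Tp Tq /andP[a0 a1] i; split=> [l|].
  by rewrite !mxE addr_ge0// mulr_ge0// ?subr_ge0// Theta_ge0.
under eq_bigr do rewrite !mxE.
by rewrite big_split/= -!mulr_sumr !Theta_sum// !mulr1 addrC subrK.
Qed.

Lemma vec_mx_continuous : continuous (@vec_mx R k n).
Proof.
move=> v A /nbhs_ballP[d d0 dA].
suff : nbhs v (vec_mx @^-1` A) by [].
apply/nbhs_ballP; exists d => //= w [_ vw]; apply: dA; split=> // i j.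
by rewrite !mxE; exact: vw.
Qed.

(** Heine-Borel is applied to row vectors: [Theta] is the image under the continuous [vec_mx] of a
    closed set lying in the unit ball of the max norm. *)
Lemma Theta_compact : closed (Theta R n k) -> compact (Theta R n k).
Proof.
move=> cT.
have -> : Theta R n k = vec_mx @` (vec_mx @^-1` Theta R n k).
  by rewrite image_preimage// -subTset => p _; exists (mxvec p) => //; exact: mxvecK.
apply: continuous_compact.
  by apply: continuous_subspaceT => v; exact: vec_mx_continuous.
apply: bounded_closed_compact; last first.
  move/continuousP: vec_mx_continuous => /(_ (~` Theta R n k)).
  by rewrite -!openC preimage_setC; apply; rewrite openC.
exists 1; split; first exact: num_real.
move=> M M1 v Tv; rewrite /Num.norm/= mx_normrE; apply: bigmax_le => [|[a b] _].
  by lra.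
rewrite ord1 /=; case/mxvec_indexP: b => i j.
have -> : v 0 (mxvec_index i j) = (vec_mx v) i j by rewrite mxE.
by rewrite ger0_norm ?Theta_ge0//; have := Theta_le1 _ i j Tv; lra.
Qed.

End Simplices.

(** * Borel sets of matrices and full support *)

Section BorelMatrices.
Context {R : realType} {n k : nat}.

Lemma open_measurableM (G : set 'M[R]_(k, n)) :
  open G -> measurable (G : set (BorelM R n k)).
Proof. by move=> oG; apply: sub_sigma_algebra. Qed.

Lemma closed_measurableM (F : set 'M[R]_(k, n)) :
  closed F -> measurable (F : set (BorelM R n k)).
Proof.
by move=> cF; rewrite -[F]setCK; apply: measurableC; apply: open_measurableM; rewrite openC.
Qed.

Lemma continuous_measurableM (f : 'M[R]_(k, n) -> R) (D : set (BorelM R n k)) :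
  measurable D -> continuous f -> measurable_fun D (f : BorelM R n k -> R).
Proof.
move=> mD /continuousP cf; apply: (measurable_funS measurableT) => //.
apply: (measurability _ (RGenOpens.measurableE R)).
move=> _ [_ [a [b ->] <-]]; rewrite setTI; apply: open_measurableM.
exact/cf/interval_open.
Qed.

(** If the mass vanished, [G] would be null because the complement of [Theta] is; the closed
    complement of [G] would then have mass one and contain [p], which lies in [G]. *)
Lemma full_support_open_gt0 (nu0 : probability (BorelM R n k) R)
    (G : set 'M[R]_(k, n)) p : full_support nu0 -> open G -> Theta R n k p ->
  G p -> (0 < nu0 (G `&` Theta R n k))%E.
Proof.
move=> [cT [nuT supp]] oG Tp Gp.
have mG := open_measurableM _ oG; have mT := closed_measurableM _ cT.
rewrite lt0e measure_ge0 andbT; apply/eqP => nuGT.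
have : nu0 (~` G) = 1%E.
  have nuNT : nu0 (~` Theta R n k) = 0%E.
    by rewrite probability_setC// nuT subee.
  have nuG : nu0 G = 0%E.
    rewrite (measureDI nu0 mG mT) [X in (_ + X)%E](_ : _ = 0%E) ?adde0; last exact: nuGT.
    apply/eqP; rewrite eq_le measure_ge0 andbT -nuNT; apply: le_measure.
    - by rewrite inE; apply: measurableD.
    - by rewrite inE; apply: measurableC.
    - by move=> ? [].
  by rewrite probability_setC// nuG sube0.
move=> /supp -/(_ _ p Tp); apply => //.
by rewrite closedC.
Qed.

End BorelMatrices.

(** * One-step gains and the wealth of a fixed portfolio map: bounds, Lipschitz estimates,
    continuity, concavity *)

Lemma sum_continuous_at {R : realType} {T : topologicalType} {I : finType}
    (f : I -> T -> R) (x : T) : (forall i, {for x, continuous (f i)}) ->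
  {for x, continuous (fun y => \sum_i f i y)}.
Proof.
move=> cf; elim: (index_enum _) => [|i s IH].
  rewrite (_ : (fun y => _) = cst 0); first exact: cst_continuous.
  by apply/funext => y; rewrite big_nil.
rewrite (_ : (fun y => _) = f i + (fun y => \sum_(j <- s) f j y)).
  by apply: continuousD; [exact: cf|exact: IH].
by apply/funext => y; rewrite big_cons.
Qed.

(** The factor multiplying the wealth when the market moves from [e i] to [e j]; up to unfolding
    [mu], the recursion of [relval] uses it at [idx t] and [idx t.+1]. *)
Definition gain {R : realType} {n k : nat} (e : 'I_k -> 'rV[R]_n) (i j : 'I_k)
    (p : 'M[R]_(k, n)) : R :=
  \sum_l p i l * (e j ord0 l / e i ord0 l).

Section Gain.
Context {R : realType} {n k : nat} (e : 'I_k -> 'rV[R]_n).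
Hypothesis e_in : forall j, open_simplex (e j).
Implicit Types (p q : 'M[R]_(k, n)) (idx : nat -> 'I_k).

Lemma ratio_bounds : exists c C : R, [/\ 0 < c, 0 < C &
  forall i j l, c <= e j ord0 l / e i ord0 l <= C].
Proof.
pose r (x : 'I_k * 'I_k * 'I_n) := e x.1.2 ord0 x.2 / e x.1.1 ord0 x.2.
have r_gt0 x : 0 < r x.
  by rewrite divr_gt0//; [have [+ _] := e_in x.1.2; exact | have [+ _] := e_in x.1.1; exact].
(* The default value 1 keeps both extrema positive, also over an empty index type. *)
exists (\big[Num.min/1]_x r x), (\big[Num.max/1]_x r x); split.
- by apply: lt_bigmin.
- by rewrite (lt_le_trans ltr01)// bigmax_ge_id.
- move=> i j l; apply/andP; split.
    exact: (bigmin_le _ (i, j, l)).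
  exact: (le_bigmax _ _ (i, j, l)).
Qed.

(** Rows of [p] are probability vectors, so a gain is a convex combination of market weight ratios
    and inherits their bounds. *)
Lemma gain_bounds : exists c C : R, [/\ 0 < c, 0 < C &
  forall i j p, Theta R n k p -> c <= gain e i j p <= C].
Proof.
have [c [C [c0 C0 rcC]]] := ratio_bounds; exists c, C; split => // i j p Tp.
rewrite -[c]mul1r -[C]mul1r -(Theta_sum _ i Tp) !mulr_suml.
by apply/andP; split; apply: ler_sum => l _; rewrite ler_wpM2l ?Theta_ge0//;
  have /andP[] := rcC i j l.
Qed.

Lemma gain_gt0 i j p : Theta R n k p -> 0 < gain e i j p.
Proof.
have [c [C [c0 _ gcC]]] := gain_bounds.
by move=> /(gcC i j)/andP[+ _]; apply: lt_le_trans.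
Qed.

Lemma ln_gain_bounded : exists M : R, 0 < M /\
  forall i j p, Theta R n k p -> `|ln (gain e i j p)| <= M.
Proof.
have [c [C [c0 C0 gcC]]] := gain_bounds.
exists (`|ln c| + `|ln C| + 1); split=> [|i j p Tp].
  by rewrite ltr_wpDl ?addr_ge0.
have /andP[cg gC] := gcC i j p Tp; have g0 := gain_gt0 i j p Tp.
have lcg : ln c <= ln (gain e i j p) by rewrite ler_ln ?posrE.
have lgC : ln (gain e i j p) <= ln C by rewrite ler_ln ?posrE.
have := ler_norm (ln C); have := ler_norm (- ln c); rewrite normrN.
have := normr_ge0 (ln C); have := normr_ge0 (ln c).
by rewrite ler_norml; lra.
Qed.

(** By [ln (1 + x) <= x], the difference of the logarithms is at most the difference of the gains
    over the second gain. The numerator is at most [n C d] and the denominator at least [c], whence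
    [K = n C / c]. *)
Lemma ln_gain_lipschitz : exists K : R, 0 <= K /\
  forall i j p q (d : R), Theta R n k p -> Theta R n k q ->
    (forall l, `|p i l - q i l| <= d) ->
    ln (gain e i j p) <= ln (gain e i j q) + K * d.
Proof.
have [c [Cg [c0 _ gc]]] := gain_bounds; have [c' [C [c'0 C0 rC]]] := ratio_bounds.
exists (n%:R * C / c); split=> [|i j p q d Tp Tq pqd].
  by rewrite divr_ge0 ?mulr_ge0// ltW.
have gp := gain_gt0 i j p Tp; have gq := gain_gt0 i j q Tq.
have /andP[cq _] := gc i j q Tq.
have pq : gain e i j p - gain e i j q <= n%:R * C * d.
  rewrite /gain -sumrB mulrAC -mulrA -[X in X%:R * _]card_ord mulr_natl -sumr_const.
  apply: ler_sum => l _; rewrite -mulrBl (le_trans (ler_norm _))// normrM.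
  have /andP[cr rC'] := rC i j l.
  rewrite ler_pM// ger0_norm//; exact: le_trans (ltW c'0) cr.
(* The sign is read off term by term from the bounds on the entries, which also covers an empty
   row. *)
have d0 : 0 <= n%:R * C * d.
  rewrite mulrAC -mulrA -[X in X%:R * _]card_ord mulr_natl -sumr_const.
  apply: sumr_ge0 => l _; rewrite mulr_ge0 ?(ltW C0)//.
  exact: le_trans (normr_ge0 _) (pqd l).
rewrite -lerBlDl -ln_div ?posrE//.
have -> : gain e i j p / gain e i j q =
    1 + (gain e i j p - gain e i j q) / gain e i j q.
  by field; rewrite gt_eqF.
apply: le_trans (le_ln1Dx _) _.
  by rewrite ltr_pdivlMr//; lra.
rewrite ler_pdivrMr// (le_trans pq)//.
have -> : n%:R * C / c * d * gain e i j q = (n%:R * C * d) * (gain e i j q / c).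
  by ring.
by rewrite ler_peMr// ler_pdivlMr// mul1r.
Qed.

Lemma relval_gt0 idx p t : Theta R n k p -> 0 < relval e idx p t.
Proof.
move=> Tp; elim: t => //= t IH.
by rewrite mulr_gt0//; exact: (gain_gt0 (idx t) (idx t.+1)).
Qed.

Lemma ln_relval idx p t : Theta R n k p ->
  ln (relval e idx p t) = \sum_(s < t) ln (gain e (idx s) (idx s.+1) p).
Proof.
move=> Tp; elim: t => [|t IH]; first by rewrite big_ord0 /= ln1.
by rewrite big_ord_recr/= -IH -lnM ?posrE ?relval_gt0 ?gain_gt0.
Qed.

(** The one-step constant serves at every step, so [K] depends neither on the market path nor on
    [t]. *)
Lemma ln_relval_lipschitz : exists K : R, 0 <= K /\
  forall idx t p q (d : R), Theta R n k p -> Theta R n k q ->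
    (forall i l, `|p i l - q i l| <= d) ->
    ln (relval e idx p t) <= ln (relval e idx q t) + t%:R * (K * d).
Proof.
have [K [K0 gK]] := ln_gain_lipschitz; exists K; split=> // idx t p q d Tp Tq pqd.
rewrite !ln_relval// -[t in t%:R]card_ord mulr_natl -sumr_const -big_split/=.
by apply: ler_sum => s _; exact: gK.
Qed.

Lemma gain_continuous i j : continuous (gain e i j).
Proof.
move=> p; apply: sum_continuous_at => l.
by apply: continuousM; [exact: coord_continuous|exact: cst_continuous].
Qed.

Lemma relval_continuous idx t : continuous (relval e idx ^~ t).
Proof.
elim: t => [|t IH]; first exact: cst_continuous.
by move=> p; apply: continuousM; [exact: IH|exact: gain_continuous].
Qed.

Lemma relval_bounded idx t : exists M : R,
  forall p, Theta R n k p -> relval e idx p t <= M.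
Proof.
have [c [C [c0 C0 gcC]]] := gain_bounds; exists (C ^+ t) => p Tp.
elim: t => //= t IH; rewrite exprSr.
apply: ler_pM => //; first by rewrite ltW// relval_gt0.
  by rewrite ltW//; exact: (gain_gt0 (idx t) (idx t.+1)).
by have /andP[_] := gcC (idx t) (idx t.+1) p Tp.
Qed.

(** The gain is affine in the portfolio map and [ln] is concave. *)
Lemma ln_gain_concave i j p q (a : R) : Theta R n k p -> Theta R n k q ->
  0 <= a <= 1 ->
  a * ln (gain e i j p) + (1 - a) * ln (gain e i j q) <=
  ln (gain e i j (a *: p + (1 - a) *: q)).
Proof.
move=> Tp Tq a01.
have -> : gain e i j (a *: p + (1 - a) *: q) =
    a * gain e i j p + (1 - a) * gain e i j q.
  rewrite /gain !mulr_sumr -big_split; apply: eq_bigr => l _.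
  by rewrite !mxE/= mulrDl !mulrA.
have /andP[a0 a1] := a01.
have := concave_ln (Itv01 a0 a1) (gain_gt0 i j p Tp) (gain_gt0 i j q Tq).
by rewrite !convRE.
Qed.

End Gain.

(** * Cover's wealth, its comparison with single portfolio maps, and universality *)

Section Wealth.
Context {R : realType} {n k : nat} (e : 'I_k -> 'rV[R]_n).
Hypothesis e_in : forall j, open_simplex (e j).
Variables (nu0 : probability (BorelM R n k) R).
Hypothesis hsupp : full_support nu0.
Implicit Types (p q : 'M[R]_(k, n)) (idx : nat -> 'I_k) (t : nat).

Let mTheta : measurable (Theta R n k : set (BorelM R n k)).
Proof. by case: hsupp => /closed_measurableM. Qed.

Lemma measurable_relval idx t (B : set (BorelM R n k)) : measurable B ->
  measurable_fun B (fun p : BorelM R n k => (relval e idx p t)%:E).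
Proof.
move=> mB; apply/measurable_EFinP; apply: continuous_measurableM => //.
exact: relval_continuous.
Qed.

Lemma integral_relval_ge0 idx t (B : set (BorelM R n k)) : B `<=` Theta R n k ->
  (0 <= \int[nu0]_(p in B) (relval e idx p t)%:E)%E.
Proof.
by move=> BT; apply: integral_ge0 => p /BT Tp; rewrite lee_fin ltW// relval_gt0.
Qed.

Lemma integral_relval_le idx t (B : set (BorelM R n k)) (M : R) :
  measurable B -> B `<=` Theta R n k -> 0 <= M ->
  (forall p, B p -> relval e idx p t <= M) ->
  (\int[nu0]_(p in B) (relval e idx p t)%:E <= M%:E)%E.
Proof.
move=> mB BT M0 BM.
apply: (@le_trans _ _ (\int[nu0]_(p in B) (cst M%:E p))%E).
  apply: ge0_le_integral => //.
  - by move=> p /BT Tp; rewrite lee_fin ltW// relval_gt0.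
  - exact: measurable_relval.
rewrite integral_cst// -[leRHS]mule1; apply: lee_pmul => //.
exact: probability_le1.
Qed.

Lemma integral_relval_ge idx t (B : set (BorelM R n k)) (m : R) :
  measurable B -> B `<=` Theta R n k -> 0 <= m ->
  (forall p, B p -> m <= relval e idx p t) ->
  (m%:E * nu0 B <= \int[nu0]_(p in B) (relval e idx p t)%:E)%E.
Proof.
move=> mB BT m0 Bm; rewrite -integral_cst//.
apply: ge0_le_integral => //.
exact: measurable_relval.
Qed.

(** The wealth at time [t] is bounded on [Theta], so the integral is finite and [fine] loses
    nothing. *)
Lemma VhatE idx t :
  (Vhat e idx nu0 t)%:E = (\int[nu0]_(p in (Theta R n k : set (BorelM R n k)))
     (relval e idx p t)%:E)%E.
Proof.
have [M HM] := relval_bounded e e_in idx t.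
rewrite /Vhat fineK// ge0_fin_numE; last exact: integral_relval_ge0.
apply: (@le_lt_trans _ _ (`|M|%:E)%E); last exact: ltry.
by apply: integral_relval_le => // p /HM; move/le_trans; apply; exact: ler_norm.
Qed.

(** For [q] within [d / 2] of [p], the ball of radius [d] about [q] contains the ball of radius
    [d / 2] about [p], whose mass is positive by full support. Compactness turns these local lower
    bounds into a single [m]. *)
Lemma mass_ball_gt0 (d : R) : 0 < d -> exists m : R, 0 < m /\
  forall p, Theta R n k p -> (m%:E <= nu0 ((ball p d) `&` Theta R n k))%E.
Proof.
move=> d0; have [cT _] := hsupp.
have /compact_near_coveringP/near_covering_withinP cov := Theta_compact cT.
have mball p r : measurable (ball p r `&` Theta R n k : set (BorelM R n k)).
  by apply: measurableI => //; apply: open_measurableM; exact: ball_open.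
pose P (m : R) p := (m%:E <= nu0 ((ball p d) `&` Theta R n k))%E.
have : \forall m \near 0^'+, Theta R n k `<=` P m.
  apply: cov => p Tp.
  have d20 : 0 < d / 2 by rewrite divr_gt0.
  have m0 : (0 < nu0 (ball p (d / 2) `&` Theta R n k))%E.
    by apply: (full_support_open_gt0 _ _ p) => //; [exact: ball_open|exact: ballxx].
  have mfin : nu0 (ball p (d / 2) `&` Theta R n k) \is a fin_num.
    by rewrite fin_num_measure.
  near=> q m.
  have pq : ball p (d / 2) q by near: q; exact: nbhsx_ballx.
  have mle : m <= fine (nu0 (ball p (d / 2) `&` Theta R n k)).
    by near: m; apply: nbhs_right_le; rewrite fine_gt0// m0 ltey_eq mfin.
  move=> Tq; rewrite /P.
  apply: (@le_trans _ _ (nu0 (ball p (d / 2) `&` Theta R n k))).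
    by rewrite -(fineK mfin) lee_fin.
  apply: le_measure; rewrite ?inE//.
  move=> x [px Tx]; split=> //; rewrite [d]splitr; apply: ball_triangle px.
  exact: ball_sym.
(* Choosing [m] to the right of 0 makes it positive. *)
move=> H; near (0:R)^'+ => m; exists m; split => //.
by move=> p; move: p; near: m.
Unshelve. all: by end_near. Qed.

Lemma Vhat_gt0 idx t : 0 < Vhat e idx nu0 t.
Proof.
have [cT [nuT _]] := hsupp.
have [c [C [c0 C0 gcC]]] := gain_bounds e e_in.
rewrite -lte_fin VhatE.
apply: (@lt_le_trans _ _ ((c ^+ t)%:E * nu0 (Theta R n k))%E).
  by rewrite nuT mule1 lte_fin exprn_gt0.
apply: integral_relval_ge => //; first by rewrite exprn_ge0// ltW.
move=> p Tp; elim: t => //= t IH; rewrite exprSr.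
apply: ler_pM => //; first by rewrite exprn_ge0// ltW.
  exact: ltW.
by have /andP[] := gcC (idx t) (idx t.+1) p Tp.
Qed.

Lemma integral_relval_near (eps : R) : 0 < eps -> exists d : R, 0 < d /\
  forall idx t p (B : set (BorelM R n k)), Theta R n k p -> measurable B ->
  B `<=` ball p d `&` Theta R n k ->
  ((expR (ln (relval e idx p t) - t%:R * eps))%:E * nu0 B <=
   \int[nu0]_(q in B) (relval e idx q t)%:E)%E.
Proof.
move=> eps0; have [K [K0 HK]] := ln_relval_lipschitz e e_in.
have K10 : 0 < K + 1 by rewrite ltr_wpDl.
(* Since [K] may vanish, the division is by [K + 1]; still [K d <= eps]. *)
exists (eps / (K + 1)); split=> [|idx t p B Tp mB BpT]; first by rewrite divr_gt0.
apply: integral_relval_ge => // [q /BpT[]//|q /BpT[[_ pq] Tq]].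
rewrite -[leRHS]lnK ?posrE ?relval_gt0// ler_expR lerBlDr.
apply: le_trans (HK idx t p q (eps / (K + 1)) Tp Tq _) _.
  by move=> i l; apply/ltW/pq.
rewrite lerD2l ler_wpM2l// mulrA ler_pdivrMr//.
by rewrite mulrC ler_pM2l// lerDl.
Qed.

(** The ball about [p] alone contributes at least [m V_p(t) exp (- t eps)] to [Vhat], where [m]
    bounds the mass of all such balls from below; the constant is therefore [- ln m], uniform in
    [p], [t] and the path. *)
Lemma ln_relval_le_Vhat (eps : R) : 0 < eps -> exists C : R,
  forall idx t p, Theta R n k p ->
  ln (relval e idx p t) <= ln (Vhat e idx nu0 t) + C + t%:R * eps.
Proof.
move=> eps0; have [d [d0 Hd]] := integral_relval_near eps eps0.
have [m [m0 Hm]] := mass_ball_gt0 d d0.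
exists (- ln m) => idx t p Tp.
pose a := ln (relval e idx p t) - t%:R * eps.
have : expR a * m <= Vhat e idx nu0 t.
  have mB : measurable (ball p d `&` Theta R n k : set (BorelM R n k)).
    by apply: measurableI => //; apply: open_measurableM; exact: ball_open.
  rewrite -lee_fin VhatE EFinM.
  apply: (@le_trans _ _ ((expR a)%:E * nu0 (ball p d `&` Theta R n k))%E).
    by apply: lee_pmul => //; [rewrite lee_fin ltW|exact: Hm].
  apply: le_trans (Hd idx t p _ Tp mB _) _ => //.
  apply: ge0_subset_integral => //; first exact: measurable_relval.
  by move=> x Tx; rewrite lee_fin ltW// relval_gt0.
move=> H; have : ln (expR a * m) <= ln (Vhat e idx nu0 t).
  by rewrite ler_ln ?posrE ?mulr_gt0 ?expR_gt0// Vhat_gt0.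
by rewrite lnM ?posrE ?expR_gt0// expRK /a; lra.
Qed.

Lemma Vhat_le_bound idx t (M : R) : 0 <= M ->
  (forall p, Theta R n k p -> relval e idx p t <= M) -> Vhat e idx nu0 t <= M.
Proof.
by move=> M0 HM; rewrite -lee_fin VhatE; exact: integral_relval_le.
Qed.

Lemma Theta_nonempty : exists p, Theta R n k p.
Proof.
apply: contrapT => T0; have [_ [nuT _]] := hsupp.
move: nuT; rewrite (_ : Theta R n k = set0) ?measure0.
  by move=> [] /eqP; rewrite eq_sym oner_eq0.
by rewrite -subset0 => p Tp; apply: T0; exists p.
Qed.

Lemma relval_le_Vstar idx t p : Theta R n k p ->
  relval e idx p t <= Vstar e idx t.
Proof.
move=> Tp; have [M HM] := relval_bounded e e_in idx t.
by apply: ub_le_sup; [exists M => _ [q /HM ? <-]|exists p].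
Qed.

Lemma Vstar_gt0 idx t : 0 < Vstar e idx t.
Proof.
have [p Tp] := Theta_nonempty.
exact: lt_le_trans (relval_gt0 e e_in idx p t Tp) (relval_le_Vstar _ _ _ Tp).
Qed.

(** An average is at most the supremum; conversely the comparison with single maps is uniform in
    [p], so it passes to the supremum, and its constant is negligible against [t]. *)
Lemma Vhat_universality idx :
  (fun t : nat => t%:R^-1 * ln (Vhat e idx nu0 t / Vstar e idx t)) @ \oo
    --> (0 : R).
Proof.
apply/cvgrPdist_le => eps eps0.
have e20 : 0 < eps / 2 by rewrite divr_gt0.
have [C HC] := ln_relval_le_Vhat _ e20.
have [p Tp] := Theta_nonempty.
near=> t.
have t0 : 0 < t%:R :> R by rewrite ltr0n; near: t; exact: nbhs_infty_gt.
have tC : `|C| <= t%:R * (eps / 2).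
  by rewrite -ler_pdivrMr ?divr_gt0//; near: t; exact: nbhs_infty_ger.
have Vh := Vhat_gt0 idx t; have Vs := Vstar_gt0 idx t.
rewrite sub0r normrN normrM ger0_norm ?invr_ge0 ?(ltW t0)// ler_pdivrMl//.
rewrite ln_div ?posrE//.
have hs : ln (Vhat e idx nu0 t) <= ln (Vstar e idx t).
  rewrite ler_ln ?posrE//; apply: Vhat_le_bound; first exact: ltW.
  by move=> q; exact: relval_le_Vstar.
(* [Vstar] is a supremum of wealths, not of logarithms, so the uniform bound is exponentiated
   first. *)
have sh : ln (Vstar e idx t) <= ln (Vhat e idx nu0 t) + C + t%:R * (eps / 2).
  rewrite -[leRHS]expRK ler_ln ?posrE ?expR_gt0//.
  apply: ge_sup; first by exists (relval e idx p t), p.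
  move=> _ [q Tq <-]; rewrite -[leLHS]lnK ?posrE ?relval_gt0// ler_expR.
  exact: HC.
have := ler_norm C; rewrite ler_norml; lra.
Unshelve. all: by end_near. Qed.

End Wealth.

(** * Expected logarithmic growth under a pair distribution, and criteria for extended limits *)

Definition growth {R : realType} {n k : nat} (e : 'I_k -> 'rV[R]_n)
    (P : 'I_k -> 'I_k -> R) (p : 'M[R]_(k, n)) : R :=
  \sum_i \sum_j P i j * ln (gain e i j p).

(** Used to regroup time averages along the path by pairs of states, with empirical frequencies as
    weights. *)
Lemma sum_indicator2 {R : realType} {k : nat} (F : 'I_k -> 'I_k -> R) a b :
  \sum_i \sum_j F i j * ((a == i) && (b == j))%:R = F a b.
Proof.
rewrite (bigD1 a)//= [X in _ + X]big1 ?addr0 => [|i /negbTE ia]; last first.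
  by apply: big1 => j _; rewrite eq_sym ia mulr0.
rewrite (bigD1 b)//= [X in _ + X]big1 ?addr0 => [|j /negbTE jb]; last first.
  by rewrite [b == j]eq_sym jb andbF mulr0.
by rewrite !eqxx mulr1.
Qed.

Lemma limn_esup_le_near {R : realType} (u : nat -> \bar R) (l : R) :
  (forall eps : R, 0 < eps -> \forall t \near \oo, (u t <= (l + eps)%:E)%E) ->
  (limn_esup u <= l%:E)%E.
Proof.
move=> H; apply/lee_addgt0Pr => eps eps0.
rewrite -EFinD; apply: (@le_trans _ _ (ereal_sup (u @` [set t | (u t <= (l + eps)%:E)%E]))).
  (* The limit superior is an infimum over eventual sets, and the set where the bound holds is one
     of them. *)
  by apply: ereal_inf_lbound; exists [set t | (u t <= (l + eps)%:E)%E] => //; exact: H.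
by apply: ge_ereal_sup => _ [t ? <-].
Qed.

Lemma limn_einf_ge_near {R : realType} (u : nat -> \bar R) (l : R) :
  (forall eps : R, 0 < eps -> \forall t \near \oo, ((l - eps)%:E <= u t)%E) ->
  (l%:E <= limn_einf u)%E.
Proof.
move=> H; rewrite /limn_einf leeNr -EFinN; apply: limn_esup_le_near => eps eps0.
apply: filterS (H eps eps0) => t.
by rewrite leeNl -EFinN opprD opprK.
Qed.

(** * Uniform growth rates and the two large deviation bounds *)

Section LargeDeviations.
Context {R : realType} {n k : nat} (e : 'I_k -> 'rV[R]_n).
Hypothesis e_in : forall j, open_simplex (e j).
Variables (idx : nat -> 'I_k) (P : 'I_k -> 'I_k -> R).
Hypotheses (P_mass : is_prob_mass P) (P_cvg : empirical_weak_cvg idx P).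
Implicit Types p q : 'M[R]_(k, n).

(* The empirical pair measure converges in total variation since [E] is finite,
   and the logarithms of the one-step gains are uniformly bounded on [Theta]. *)
Lemma growth_uniform (eps : R) : 0 < eps -> \forall t \near \oo,
  forall p, Theta R n k p ->
    `|t%:R^-1 * ln (relval e idx p t) - growth e P p| <= eps.
Proof.
move=> eps0; have [M [M0 HM]] := ln_gain_bounded e e_in.
(* The [k * k] pairs each contribute at most [d M]; the added 1 keeps the denominator positive. *)
pose d := eps / (k%:R * k%:R * M + 1).
have D0 : 0 < k%:R * k%:R * M + 1 by rewrite ltr_wpDl// !mulr_ge0// ltW.
have d0 : 0 < d by rewrite divr_gt0.
pose freq (x : 'I_k * 'I_k) t : R :=
  t%:R^-1 * \sum_(s < t) ((idx s == x.1) && (idx s.+1 == x.2))%:R.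
have : \forall t \near \oo, forall x, `|P x.1 x.2 - freq x t| <= d.
  apply: filter_forall => x.
  (* Weak convergence is tested on the indicator of the single pair [x]. *)
  have /cvgrPdist_le/(_ d d0) := P_cvg (fun i j => ((i == x.1) && (j == x.2))%:R).
  apply: filterS => t; congr (`| _ - _ | <= _).
  rewrite -[RHS](sum_indicator2 P).
  by apply: eq_bigr => i _; apply: eq_bigr => j _; rewrite [_ == i]eq_sym [_ == j]eq_sym.
apply: filterS => t Ht p Tp.
have -> : t%:R^-1 * ln (relval e idx p t) =
    \sum_i \sum_j freq (i, j) t * ln (gain e i j p).
  rewrite (ln_relval e e_in)// mulr_sumr.
  under [RHS]eq_bigr => i _ do under eq_bigr => j _ do
    rewrite /freq/= -mulrA mulr_suml mulr_sumr.
  under [RHS]eq_bigr => i _ do rewrite exchange_big.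
  rewrite exchange_big; apply: eq_bigr => s _ /=.
  rewrite -(sum_indicator2 (fun i j => ln (gain e i j p)) (idx s) (idx s.+1)) mulr_sumr.
  apply: eq_bigr => i _; rewrite mulr_sumr; apply: eq_bigr => j _.
  by rewrite [ln _ * _]mulrC.
rewrite /growth -sumrB (le_trans (ler_norm_sum _ _ _))//.
apply: (@le_trans _ _ (\sum_(i < k) \sum_(j < k) d * M)).
  apply: ler_sum => i _; rewrite -sumrB (le_trans (ler_norm_sum _ _ _))//.
  apply: ler_sum => j _; rewrite -mulrBl normrM ler_pM//; last exact: HM.
  by rewrite distrC; exact: (Ht (i, j)).
rewrite !sumr_const card_ord -[leLHS]mulr_natl -[d * M *+ k]mulr_natl /d.
rewrite (_ : _ * _ = eps * (k%:R * k%:R * M) / (k%:R * k%:R * M + 1)); last by ring.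
by rewrite ler_pdivrMr// ler_pM2l// lerDl.
Qed.

Lemma growth_cvg p : Theta R n k p ->
  (fun t : nat => t%:R^-1 * ln (relval e idx p t)) @ \oo --> growth e P p.
Proof.
move=> Tp; apply/cvgrPdist_le => eps /growth_uniform.
by apply: filterS => t; rewrite distrC; exact.
Qed.

(** Replaces the abstract limit by an expected logarithmic gain, whose continuity and concavity can
    be checked term by term. *)
Lemma Wgrowth_growth p : Theta R n k p -> Wgrowth e idx p = growth e P p.
Proof. by move=> Tp; apply/cvg_lim => //; exact: growth_cvg. Qed.

Lemma growth_continuous : {within Theta R n k, continuous (growth e P)}.
Proof.
apply: continuous_in_subspaceT => p; rewrite inE => Tp.
apply: sum_continuous_at => i; apply: sum_continuous_at => j.
apply: continuousM; first exact: cst_continuous.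
apply: continuous_comp; first exact: gain_continuous.
by apply: continuous_ln; exact: gain_gt0.
Qed.

Lemma growth_concave p q (a : R) : Theta R n k p -> Theta R n k q ->
  0 <= a <= 1 ->
  a * growth e P p + (1 - a) * growth e P q <=
  growth e P (a *: p + (1 - a) *: q).
Proof.
move=> Tp Tq a01; rewrite /growth !mulr_sumr -big_split/=.
apply: ler_sum => i _; rewrite !mulr_sumr -big_split/=.
apply: ler_sum => j _.
rewrite mulrCA [(1 - a) * _]mulrCA -mulrDr ler_wpM2l//; first exact: P_mass.1.
exact: ln_gain_concave.
Qed.

Variable nu0 : probability (BorelM R n k) R.
Hypothesis hsupp : full_support nu0.

Lemma growth_max : exists2 p0, Theta R n k p0 &
  forall p, Theta R n k p -> growth e P p <= growth e P p0.
Proof.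
have [p0 Tp0 Hp0] := compact_EVT_max (Theta_nonempty nu0 hsupp)
  (Theta_compact hsupp.1) growth_continuous.
exists p0; first by rewrite inE in Tp0.
by move=> p Tp; apply: Hp0; rewrite inE.
Qed.

Lemma Wstar_growth p0 : Theta R n k p0 ->
  (forall p, Theta R n k p -> growth e P p <= growth e P p0) ->
  Wstar e idx = growth e P p0.
Proof.
move=> Tp0 maxp0.
have ub : ubound [set Wgrowth e idx p | p in Theta R n k] (growth e P p0).
  by move=> _ [p Tp <-]; rewrite Wgrowth_growth//; exact: maxp0.
apply/eqP; rewrite eq_le; apply/andP; split.
  by apply: ge_sup => //; exists (Wgrowth e idx p0), p0.
by apply: ub_le_sup; [exists (growth e P p0)|exists p0 => //; exact: Wgrowth_growth].
Qed.

Lemma growth_le_Wstar p : Theta R n k p -> growth e P p <= Wstar e idx.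
Proof.
by have [p0 Tp0 maxp0] := growth_max; rewrite (Wstar_growth _ Tp0 maxp0); exact: maxp0.
Qed.

Lemma ln_Vhat_growth (eps : R) : 0 < eps -> \forall t \near \oo,
  `|t%:R^-1 * ln (Vhat e idx nu0 t) - Wstar e idx| <= eps.
Proof.
(* One third each for the uniform convergence, the comparison with [Vhat] and the constant [C]. *)
move=> eps0; have e30 : 0 < eps / 3 by rewrite divr_gt0.
have [C HC] := ln_relval_le_Vhat e e_in nu0 hsupp _ e30.
have [p0 Tp0 maxp0] := growth_max.
near=> t.
have t0 : 0 < t%:R :> R by rewrite ltr0n; near: t; exact: nbhs_infty_gt.
have tC : `|C| <= t%:R * (eps / 3).
  by rewrite -ler_pdivrMr//; near: t; exact: nbhs_infty_ger.
have unif p : Theta R n k p ->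
    `|t%:R^-1 * ln (relval e idx p t) - growth e P p| <= eps / 3.
  by move: p; near: t; exact: growth_uniform.
have Vh := Vhat_gt0 e e_in nu0 hsupp idx t.
have up : ln (Vhat e idx nu0 t) <= t%:R * (Wstar e idx + eps / 3).
  rewrite -[leRHS]expRK ler_ln ?posrE ?expR_gt0//.
  apply: (Vhat_le_bound e e_in nu0 hsupp) => [|p Tp]; first exact: expR_ge0.
  rewrite -[leLHS]lnK ?posrE ?relval_gt0// ler_expR -ler_pdivrMl//.
  by have := unif p Tp; have := growth_le_Wstar p Tp; rewrite ler_norml; lra.
have lo : t%:R * (Wstar e idx - eps / 3) <= ln (relval e idx p0 t).
  rewrite -ler_pdivlMl// (Wstar_growth p0)//.
  by have := unif p0 Tp0; rewrite ler_norml; lra.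
have := HC idx t p0 Tp0; have := ler_norm C => C1 C2.
rewrite -(ler_pM2l t0) -[X in X * `|_|]ger0_norm ?(ltW t0)// -normrM mulrBr mulVKf ?gt_eqF//.
rewrite ler_norml; lra.
Unshelve. all: by end_near. Qed.

Let mTheta : measurable (Theta R n k : set (BorelM R n k)).
Proof. exact: closed_measurableM hsupp.1. Qed.

Lemma nu_t_ge0 t (B : set (BorelM R n k)) : B `<=` Theta R n k ->
  (0 <= nu_t e idx nu0 t B)%E.
Proof.
move=> BT; apply: mule_ge0; last exact: integral_relval_ge0.
by rewrite lee_fin invr_ge0 ltW// Vhat_gt0.
Qed.

(** On [B] all wealths are at most [exp (t (W^* + l + eps / 2))] for large [t], and dividing by
    [Vhat] removes [W^*] at the price of another [eps / 2]. *)
Lemma nu_t_upper_bound (B : set (BorelM R n k)) (l : R) : measurable B ->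
  B `<=` Theta R n k ->
  (forall p, B p -> growth e P p - Wstar e idx <= l) ->
  (limn_esup (fun t : nat => (t%:R^-1)%:E * lne (nu_t e idx nu0 t B)) <=
   l%:E)%E.
Proof.
move=> mB BT Bl; apply: limn_esup_le_near => eps eps0.
have e20 : 0 < eps / 2 by rewrite divr_gt0.
near=> t.
have t0 : 0 < t%:R :> R by rewrite ltr0n; near: t; exact: nbhs_infty_gt.
have unif p : Theta R n k p ->
    `|t%:R^-1 * ln (relval e idx p t) - growth e P p| <= eps / 2.
  by move: p; near: t; exact: growth_uniform.
have Vgrow : `|t%:R^-1 * ln (Vhat e idx nu0 t) - Wstar e idx| <= eps / 2.
  by near: t; exact: ln_Vhat_growth.
have Vh := Vhat_gt0 e e_in nu0 hsupp idx t.
pose M := t%:R * (Wstar e idx + l + eps / 2).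
pose x := M - ln (Vhat e idx nu0 t).
have nux : (nu_t e idx nu0 t B <= (expR x)%:E)%E.
  have -> : expR x = (Vhat e idx nu0 t)^-1 * expR M.
    by rewrite /x expRD expRN lnK ?posrE// mulrC.
  rewrite /nu_t EFinM; apply: lee_wpmul2l; first by rewrite lee_fin invr_ge0 ltW.
  apply: integral_relval_le => // p Bp.
  have Tp := BT p Bp.
  rewrite -[leLHS]lnK ?posrE ?relval_gt0// ler_expR -ler_pdivrMl//.
  by have := unif p Tp; have := Bl p Bp; rewrite ler_norml; lra.
(* Comparing through [lne] on the extended nonnegative reals also covers [nu_t] of mass 0. *)
apply: (@le_trans _ _ ((t%:R^-1)%:E * x%:E)%E).
  apply: lee_wpmul2l; first by rewrite lee_fin invr_ge0 ltW.
  rewrite -[x in leRHS]expRK -lne_EFin ?expR_gt0// lee_lne// in_itv/= leey andbT.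
    exact: nu_t_ge0.
  by rewrite lee_fin expR_ge0.
rewrite -EFinM lee_fin /x mulrBr /M mulKf ?gt_eqF//.
by move: Vgrow; rewrite ler_norml; lra.
Unshelve. all: by end_near. Qed.

Lemma nu_t_lower_bound (G : set 'M[R]_(k, n)) p : open G -> G p -> Theta R n k p ->
  ((growth e P p - Wstar e idx)%:E <=
   limn_einf (fun t : nat =>
     (t%:R^-1)%:E * lne (nu_t e idx nu0 t (G `&` Theta R n k))))%E.
Proof.
move=> oG Gp Tp; apply: limn_einf_ge_near => eps eps0.
(* One quarter each for the growth of [p], the variation of the wealth over the ball, the mass of
   the ball and the growth of [Vhat]. *)
have e40 : 0 < eps / 4 by rewrite divr_gt0.
have [d [d0 Hd]] := integral_relval_near e e_in nu0 _ e40.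
(* The part of [G] near [p] suffices: its mass is positive and fixed, so [ln m] is negligible
   against [t]. *)
pose B : set (BorelM R n k) := (G `&` ball p d) `&` Theta R n k.
have oGd : open (G `&` ball p d) by apply: openI => //; exact: ball_open.
have mB : measurable B by apply: measurableI => //; exact: open_measurableM.
have mGT : measurable (G `&` Theta R n k : set (BorelM R n k)).
  by apply: measurableI => //; exact: open_measurableM.
have B0 : (0 < nu0 B)%E.
  apply: (full_support_open_gt0 _ _ p) => //.
  by split=> //; exact: ballxx.
have Bfin : nu0 B \is a fin_num by rewrite fin_num_measure.
pose m := fine (nu0 B).
have m0 : 0 < m by rewrite fine_gt0// B0 ltey_eq Bfin.
near=> t.
have t0 : 0 < t%:R :> R by rewrite ltr0n; near: t; exact: nbhs_infty_gt.
have tm : `|ln m| <= t%:R * (eps / 4).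
  by rewrite -ler_pdivrMr//; near: t; exact: nbhs_infty_ger.
have unif : `|t%:R^-1 * ln (relval e idx p t) - growth e P p| <= eps / 4.
  by move: (p) Tp; near: t; exact: growth_uniform.
have Vgrow : `|t%:R^-1 * ln (Vhat e idx nu0 t) - Wstar e idx| <= eps / 4.
  by near: t; exact: ln_Vhat_growth.
have Vh := Vhat_gt0 e e_in nu0 hsupp idx t.
pose a := ln (relval e idx p t) - t%:R * (eps / 4).
pose x := a + ln m - ln (Vhat e idx nu0 t).
have nux : ((expR x)%:E <= nu_t e idx nu0 t (G `&` Theta R n k))%E.
  have -> : expR x = (Vhat e idx nu0 t)^-1 * (expR a * m).
    by rewrite /x expRD expRN (expRD a) !lnK ?posrE// mulrC.
  rewrite /nu_t EFinM; apply: lee_wpmul2l; first by rewrite lee_fin invr_ge0 ltW.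
  rewrite EFinM /m fineK//.
  apply: le_trans (Hd idx t p B Tp mB _) _; first by move=> q [[]].
  apply: ge0_subset_integral => //.
  - exact: measurable_relval.
  - by move=> q [_ Tq]; rewrite lee_fin ltW// relval_gt0.
  - by move=> q [[]].
apply: (@le_trans _ _ ((t%:R^-1)%:E * x%:E)%E); last first.
  apply: lee_wpmul2l; first by rewrite lee_fin invr_ge0 ltW.
  rewrite -[x in leLHS]expRK -lne_EFin ?expR_gt0// lee_lne// in_itv/= leey andbT.
    by rewrite lee_fin expR_ge0.
  by apply: nu_t_ge0 => q [].
rewrite -EFinM lee_fin /x /a mulrBr !mulrDr mulrN mulKf ?gt_eqF//.
have lm : - (eps / 4) <= t%:R^-1 * ln m.
  by rewrite ler_pdivlMl// mulrN lerNl (le_trans _ tm)// -normrN ler_norm.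
by move: Vgrow unif; rewrite !ler_norml; lra.
Unshelve. all: by end_near. Qed.

End LargeDeviations.

Theorem theorem3p3 (R : realType) (n k : nat) (hn : (2 <= n)%N)
    (e : 'I_k -> 'rV[R]_n) (e_inj : injective e)
    (e_in : forall j, open_simplex (e j))
    (idx : nat -> 'I_k)
    (nu0 : probability (BorelM R n k) R)
    (hsupp : full_support nu0) :
  (* (i) universality of Cover's portfolio *)
  ((fun t : nat => t%:R^-1 * ln (Vhat e idx nu0 t / Vstar e idx t)) @ \oo
     --> (0 : R))
  /\
  (* (ii) LDP under weak convergence of the empirical pair measures *)
  (forall P : 'I_k -> 'I_k -> R, is_prob_mass P -> empirical_weak_cvg idx P ->
     (forall p, Theta R n k p ->
        (fun t : nat => t%:R^-1 * ln (relval e idx p t)) @ \oo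
          --> Wgrowth e idx p)
     /\ (exists2 p0, Theta R n k p0 &
           forall p, Theta R n k p -> Wgrowth e idx p <= Wgrowth e idx p0)
     /\ (forall p q (l : R), Theta R n k p -> Theta R n k q -> 0 <= l <= 1 ->
           rateI e idx (l *: p + (1 - l) *: q)
             <= l * rateI e idx p + (1 - l) * rateI e idx q)
     /\ (forall F : set 'M[R]_(k, n), closed F ->
           (limn_esup (fun t : nat =>
              (t%:R^-1)%:E * lne (nu_t e idx nu0 t (F `&` Theta R n k))) <=
            - ereal_inf [set (rateI e idx p)%:E | p in F `&` Theta R n k])%E)
     /\ (forall G : set 'M[R]_(k, n), open G ->
           (- ereal_inf [set (rateI e idx p)%:E | p in G `&` Theta R n k] <=
            limn_einf (fun t : nat =>
              (t%:R^-1)%:E * lne (nu_t e idx nu0 t (G `&` Theta R n k))))%E)).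
Proof.
have [cT _] := hsupp.
split=> [|P P_mass P_cvg]; first exact: Vhat_universality.
have Wg := Wgrowth_growth e e_in idx P P_cvg.
have rateE p : Theta R n k p ->
    (- (rateI e idx p)%:E)%E = (growth e P p - Wstar e idx)%:E.
  by move=> Tp; rewrite /rateI Wg// -EFinN opprB.
split; [|split; [|split; [|split]]].
- by move=> p Tp; rewrite Wg//; exact: growth_cvg.
- have [p0 Tp0 maxp0] := growth_max e e_in P nu0 hsupp.
  by exists p0 => // p Tp; rewrite !Wg//; exact: maxp0.
- move=> p q l Tp Tq l01; rewrite /rateI !Wg//; last exact: Theta_convex.
  by have := growth_concave e e_in P P_mass p q l Tp Tq l01; lra.
- move=> F cF.
  have bound (l : R) :
      (- ereal_inf [set (rateI e idx p)%:E | p in F `&` Theta R n k] <= l%:E)%E ->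
      (limn_esup (fun t : nat =>
        (t%:R^-1)%:E * lne (nu_t e idx nu0 t (F `&` Theta R n k))) <= l%:E)%E.
    move=> infl; apply: (nu_t_upper_bound e e_in idx P P_cvg nu0 hsupp).
    + by apply: measurableI; exact: closed_measurableM.
    + by move=> p [].
    + move=> p [Fp Tp]; rewrite -lee_fin -rateE//; apply: le_trans infl.
      by rewrite leeN2; apply: ereal_inf_lbound; exists p.
  (* The bound is known for real [l] only. If the right-hand side is [-oo], as when [F] misses
     [Theta], every real [l] qualifies, which forces the limit superior down to [-oo]. *)
  move: bound; case: (- _)%E => [r||] bound; [exact: bound|by rewrite leey|].
  case: (limn_esup _) bound => [x||]// bound.
    by have := bound (x - 1) (leNye _); rewrite lee_fin lerBrDr gerDl ler10.
  by have := bound 0 (leNye _); rewrite leye_eq.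
(* By definition of the infimum it suffices to treat each point of [G] in [Theta] separately. *)
- move=> G oG; rewrite leeNl; apply: le_ereal_inf_tmp => _ [p [Gp Tp] <-].
  by rewrite leeNl rateE//; exact: nu_t_lower_bound.
Qed.
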